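(* Let $E$ be a $d$-dimensional Euclidean space with norm $\|\cdot\|$. Let $\vec{v}_1, \ldots, \vec{v}_m \in E$ be vectors which span $E$ and which generate the lattice $L = \mathbb{Z}\vec{v}_1 + \cdots + \mathbb{Z}\vec{v}_m$. Define $B = \max_{i=1,\ldots,m} \|\vec{v}_i\|$. Consider the chain of lattices $$\mathbb{Z}\vec{v}_1 \subseteq \mathbb{Z}\vec{v}_1 + \mathbb{Z}\vec{v}_2 \subseteq \cdots \subseteq \mathbb{Z}\vec{v}_1 + \mathbb{Z}\vec{v}_2 + \cdots + \mathbb{Z}\vec{v}_m.$$ Then the number of indices $i \in \{2,\ldots,m\}$ for which the inclusion $\mathbb{Z}\vec{v}_1 + \cdots + \mathbb{Z}\vec{v}_{i-1} \subseteq \mathbb{Z}\vec{v}_1 + \cdots + \mathbb{Z}\vec{v}_{i}$ is strict is at most $d + \log_2\!\big(d!\,(B/\lambda_1(L))^d\big)$.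
   Context: A lattice in $E$ is a set of the form $\mathbb{Z}\vec{b}_1 + \cdots + \mathbb{Z}\vec{b}_n$ with $\vec{b}_1,\ldots,\vec{b}_n$ linearly independent; $n$ is its rank. For a lattice $L$ of rank $d$ and $k \in \{1,\ldots,d\}$, the $k$-th successive minimum $\lambda_k(L)$ is the minimum $\lambda$ such that the closed ball of radius $\lambda$ centered at the origin contains at least $k$ linearly independent points of $L$; in particular $\lambda_1(L)$ is the length of a shortest nonzero vector of $L$. *)

(* Defs.v *)
From mathcomp Require Import all_boot all_order all_algebra.
From mathcomp Require Import all_classical all_reals all_analysis.

Set Implicit Arguments.
Unset Strict Implicit.
Unset Printing Implicit Defensive.

Import Order.TTheory GRing.Theory Num.Theory.

Local Open Scope classical_set_scope.
Local Open Scope ring_scope.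

(* A Euclidean space is a finite-dimensional real vector space E : vectType R
   together with a positive definite symmetric bilinear form
   dot : {dot E for idfun}. *)
Definition enorm (R : realType) (E : vectType R) (dot : {dot E for idfun})
    (x : E) : R :=
  Num.sqrt (dot x x).

Definition zspan (V : zmodType) (s : seq V) : set V :=
  [set x | inIntSpan (in_tuple s) x].

Definition is_lattice (R : realType) (E : vectType R) (L : set E) : Prop :=
  exists b : seq E, free b /\ L = zspan b.

(* The minimum is taken literally (least element of the set of admissible
   radii); the value 0 is only a default for the case where there is none,
   e.g. when k exceeds the rank of L. *)
Definition successive_minimum (R : realType) (E : vectType R)
    (dot : {dot E for idfun}) (L : set E) (k : nat) : R :=
  let radii := [set r : R | exists2 X : k.-tuple E, free X &
                 forall x, x \in X -> L x /\ enorm dot x <= r] in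
  xget 0 (radii `&` lbound radii).

Definition max_norm (R : realType) (E : vectType R) (dot : {dot E for idfun})
    (s : seq E) : R :=
  \big[Num.max/0]_(x <- s) enorm dot x.

(* With v = (v_1, ..., v_m), the index i : 'I_m counted from 0 stands for
   i + 1 in {2, ..., m}: [take i v] lists v_1, ..., v_i. *)
Definition strict_inclusions (V : zmodType) (m : nat) (v : m.-tuple V) : nat :=
  #|[set i : 'I_m | (0 < i)%N &&
      `[< zspan (take i v) `<` zspan (take i.+1 v) >]]%SET|.

Definition log2 (R : realType) (x : R) : R := ln x / ln 2.

(* Main.v *)
(* Start the chain with the lattice 0. Call a strict inclusion a rank step if
   the new vector b lies outside the span of its predecessors, and an index
   step otherwise. There are d rank steps; let N be the number of index steps.
   Gram-Schmidt on the rank steps yields an orthonormal basis U of E, and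
   induction along the chain shows that every box of side nB with axes U
   contains 2^N n^d points of L: at an index step, the points of the old
   lattice in the box and those of its translate by b are disjoint; at a rank
   step, at least n consecutive translates by multiples of b meet the box,
   because b has component at most B along the new axis.
   Cutting the box into half-open cubes of side lambda_1 / sqrt d, each of which
   contains at most one point of L, gives
   2^N n^d <= (n B sqrt d / lambda_1 + 1)^d. Dividing by n^d and letting n go
   to infinity, 2^N <= (sqrt d)^d (B / lambda_1)^d, and (sqrt d)^d <= d!. *)

Require Import Defs.
From mathcomp Require Import all_boot all_order all_algebra.
From mathcomp Require Import all_classical all_reals all_analysis.
From mathcomp Require Import zify ring lra.

Import Order.TTheory GRing.Theory Num.Theory.
Import numFieldNormedType.Exports.

Local Open Scope classical_set_scope.
Local Open Scope ring_scope.

(** * Integer spans of finite families *)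

Section IntegerSpan.
Set Implicit Arguments.
Unset Strict Implicit.
Context (V : zmodType).
Implicit Types (s : seq V) (x y b : V).

(** Coefficients indexed by [nat] instead of by ['I_(size s)] do not change type when a generator is
    appended. *)
Lemma zspanP s x :
  zspan s x <-> exists a : nat -> int, x = \sum_(i < size s) s`_i *~ a i.
Proof.
split=> [[a ->]|[a ->]].
  exists (fun i => if insub i is Some j then a j else 0).
  by apply: eq_bigr => i _; rewrite valK.
by exists [ffun i : 'I__ => a i]; apply: eq_bigr => i _; rewrite ffunE.
Qed.

Lemma zspan0 s : zspan s 0.
Proof. by apply/zspanP; exists (fun=> 0); rewrite big1. Qed.

Lemma zspanB s x y : zspan s x -> zspan s y -> zspan s (x - y).
Proof.
move=> /zspanP[a ->] /zspanP[c ->]; apply/zspanP; exists (fun i => a i - c i).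
by rewrite -sumrB; apply: eq_bigr => i _; rewrite mulrzBr.
Qed.

Lemma zspanD s x y : zspan s x -> zspan s y -> zspan s (x + y).
Proof.
move=> sx sy; rewrite -[y]opprK -[- y]sub0r.
by do 2!apply: zspanB => //; apply: zspan0.
Qed.

Lemma zspanMz s x (k : int) : zspan s x -> zspan s (x *~ k).
Proof.
move=> /zspanP[a ->]; apply/zspanP; exists (fun i => a i * k).
by rewrite mulrz_suml; apply: eq_bigr => i _; rewrite mulrzA.
Qed.

Lemma zspan_rcons s b x :
  zspan (rcons s b) x <-> exists2 y, zspan s y & exists k, x = y + b *~ k.
Proof.
split=> [/zspanP[a]|[_ /zspanP[a ->] [k ->]]].
  rewrite size_rcons big_ord_recr /= nth_rcons ltnn eqxx => ->.
  exists (\sum_(i < size s) (rcons s b)`_i *~ a i); last by exists (a (size s)).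
  apply/zspanP; exists a; apply: eq_bigr => i _.
  by rewrite nth_rcons ltn_ord.
apply/zspanP; exists (fun i => if (i < size s)%N then a i else k).
rewrite size_rcons big_ord_recr /= nth_rcons !ltnn eqxx; congr (_ + _).
by apply: eq_bigr => i _; rewrite nth_rcons ltn_ord.
Qed.

Lemma mem_zspan s x : x \in s -> zspan s x.
Proof.
elim/last_ind: s => // s b IH; rewrite mem_rcons in_cons => /orP xP.
apply/zspan_rcons; case: xP => [/eqP ->|/IH sx].
  by exists 0; [exact: zspan0 | exists 1; rewrite add0r].
by exists x => //; exists 0; rewrite addr0.
Qed.

Lemma zspan_rcons_mem s b : zspan s b -> ~ zspan s `<` zspan (rcons s b).
Proof.
move=> sb [_]; apply => _ /zspan_rcons[y sy [k ->]].
by apply: zspanD => //; apply: zspanMz.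
Qed.

End IntegerSpan.

Lemma zspan_span (K : fieldType) (E : vectType K) (s : seq E) (x : E) :
  zspan s x -> x \in << s >>%VS.
Proof.
move=> [a ->]; apply: rpred_sum => i _.
by rewrite rpredMz // memv_span // mem_nth.
Qed.

(** * Inner products and orthonormal families *)

Section InnerProduct.
Set Implicit Arguments.
Unset Strict Implicit.
Context (R : realType) (E : vectType R) (dot : {dot E for idfun}).
Implicit Types (x y u w b : E) (U : seq E).

Lemma dotC x y : dot x y = dot y x.
Proof. by rewrite hermC expr0 mul1r. Qed.

Lemma dotDl x y u : dot (x + y) u = dot x u + dot y u.
Proof. exact: linearDl. Qed.

Lemma dotBl x y u : dot (x - y) u = dot x u - dot y u.
Proof. exact: linearBl. Qed.

Lemma dotZl (a : R) x u : dot (a *: x) u = a * dot x u.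
Proof. exact: linearZl_LR. Qed.

Lemma dot0l u : dot 0 u = 0.
Proof. exact: linear0l. Qed.

Lemma dotMzl x (k : int) u : dot (x *~ k) u = k%:~R * dot x u.
Proof. by rewrite -scaler_int dotZl. Qed.

Lemma dot_suml (I : Type) (r : seq I) (F : I -> E) u :
  dot (\sum_(i <- r) F i) u = \sum_(i <- r) dot (F i) u.
Proof. exact: linear_sumlz. Qed.

Lemma dot_ge0 x : 0 <= dot x x.
Proof. by have [->|/neq0_dnorm_gt0/ltW//] := eqVneq x 0; rewrite dot0l. Qed.

Lemma enorm_ge0 x : 0 <= enorm dot x.
Proof. exact: sqrtr_ge0. Qed.

Lemma enorm_gt0 x : x != 0 -> 0 < enorm dot x.
Proof. by move=> x0; rewrite sqrtr_gt0 neq0_dnorm_gt0. Qed.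

Lemma sqr_enorm x : enorm dot x ^+ 2 = dot x x.
Proof. by rewrite sqr_sqrtr ?dot_ge0. Qed.

(** The dot-product condition depends only on membership and would allow repetitions; [uniq]
    excludes them, so that sums over [U] count each axis once. *)
Definition is_orthonormal U :=
  uniq U /\ {in U &, forall u w, dot u w = (u == w)%:R}.

Lemma span_orthogonal U x w :
  x \in <<U>>%VS -> {in U, forall u, dot u w = 0} -> dot x w = 0.
Proof.
move=> /(coord_span (X := in_tuple U)) -> Uw.
rewrite dot_suml big1 // => i _.
by rewrite dotZl Uw ?mulr0 ?mem_nth.
Qed.

Lemma orthonormal_sum_dot U (a : E -> R) u : is_orthonormal U -> u \in U ->
  dot (\sum_(w <- U) a w *: w) u = a u.
Proof.
move=> [uU oU] Uu; rewrite dot_suml (bigD1_seq u) //= dotZl oU // eqxx mulr1.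
rewrite big_seq_cond big1 ?addr0 // => w /andP[Uw wu].
by rewrite dotZl oU // (negbTE wu) mulr0.
Qed.

Lemma orthonormal_sum_mem U (a : E -> R) : \sum_(w <- U) a w *: w \in <<U>>%VS.
Proof.
by rewrite big_seq; apply: rpred_sum => w Uw; rewrite rpredZ // memv_span.
Qed.

Lemma orthonormal_expand U x : is_orthonormal U -> x \in <<U>>%VS ->
  x = \sum_(u <- U) dot x u *: u.
Proof.
move=> oU Ux; set y := \sum_(u <- U) _; apply/eqP; rewrite -subr_eq0.
apply/negPn/negP => /(neq0_dnorm_gt0 (s := dot)).
rewrite (span_orthogonal (U := U)) ?ltxx // => [|u Uu].
  by rewrite rpredB // orthonormal_sum_mem.
by rewrite dotC dotBl orthonormal_sum_dot // subrr.
Qed.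

Lemma orthonormal_parseval U x : is_orthonormal U -> x \in <<U>>%VS ->
  dot x x = \sum_(u <- U) dot x u ^+ 2.
Proof.
move=> oU Ux; rewrite {1}(orthonormal_expand oU Ux) dot_suml.
by apply: eq_bigr => u _; rewrite dotZl expr2 (dotC u).
Qed.

Lemma is_orthonormal_free U : is_orthonormal U -> free U.
Proof.
elim: U => [|u U IH] [uU oU]; first exact: nil_free.
move: uU; rewrite free_cons /= => /andP[uNU uU].
rewrite IH ?andbT; last first.
  by split=> // x y Ux Uy; apply: oU; rewrite in_cons ?Ux ?Uy orbT.
apply/negP => /span_orthogonal => /(_ u); rewrite oU ?mem_head // eqxx.
move=> H; suff: (1%:R : R) = 0 by move/eqP; rewrite oner_eq0.
apply: H => w Uw; rewrite oU ?mem_head ?in_cons ?Uw ?orbT //.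
by case: eqP uNU => // <-; rewrite Uw.
Qed.

(** The vector [u] is the normalised component [c] of [b] orthogonal to [U]. Then [dot b u] is the
    length of [c], which is positive, and at most the length of [b] by Pythagoras. *)
Lemma gram_schmidt_step U b : is_orthonormal U -> b \notin <<U>>%VS ->
  exists2 u, is_orthonormal (u :: U) &
    [/\ 0 < dot b u <= enorm dot b & <<u :: U>>%VS = <<b :: U>>%VS].
Proof.
move=> oU bNU; pose p := \sum_(u <- U) dot b u *: u; pose c := b - p.
have pU : p \in <<U>>%VS by exact: orthonormal_sum_mem.
have cNU : c \notin <<U>>%VS.
  by apply: contra bNU => cU; rewrite -(subrK p b) rpredD.
have c0 : c != 0 by apply: contraNneq cNU => ->; rewrite rpred0.
have Uc w : w \in U -> dot w c = 0.
  by move=> Uw; rewrite dotC dotBl orthonormal_sum_dot // subrr.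
have bc : dot b c = dot c c.
  by rewrite -{1}(subrK p b) dotDl (span_orthogonal pU Uc) addr0.
pose s := enorm dot c; have s0 : 0 < s by exact: enorm_gt0.
have ss : s ^+ 2 = dot c c by exact: sqr_enorm.
have bu : dot b (s^-1 *: c) = s.
  by rewrite dotC dotZl dotC bc -ss expr2 mulKf // gt_eqF.
have Uu w : w \in U -> dot w (s^-1 *: c) = 0.
  by move=> Uw; rewrite dotC dotZl dotC Uc // mulr0.
have uu : dot (s^-1 *: c) (s^-1 *: c) = 1.
  by rewrite dotZl dotC dotZl -ss expr2; field; rewrite gt_eqF.
exists (s^-1 *: c).
- case: (oU) => uU dU; split.
    rewrite /= uU andbT; apply: contraNN cNU => /memv_span.
    by move/(rpredZ s); rewrite scalerA mulfV ?scale1r // gt_eqF.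
  have ne w : w \in U -> (s^-1 *: c == w) = false.
    move=> Uw; apply/eqP => e; move: (Uu _ Uw); rewrite -e uu => /eqP.
    by rewrite oner_eq0.
  move=> x y; rewrite !in_cons => /orP[/eqP ->|Ux] /orP[/eqP ->|Uy].
  + by rewrite uu eqxx.
  + by rewrite dotC Uu // ne.
  + by rewrite Uu // eq_sym ne.
  + exact: dU.
- split.
  + rewrite bu s0 /= ler_sqrt ?dot_ge0 //.
    have -> : dot b b = dot c c + dot p p.
      have -> : dot b b = dot (c + p) (c + p) by rewrite subrK.
      rewrite (dotDl c p) 2!(dotC _ (c + p)) (dotDl c p c) (dotDl c p p).
      rewrite (dotC c p).
      by rewrite (span_orthogonal pU Uc) addr0 add0r.
    by rewrite lerDl dot_ge0.
  + apply/eqP; rewrite eqEsubv; apply/andP; split; apply/span_subvP => x.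
      rewrite in_cons span_cons => /orP[/eqP ->|Ux]; last first.
        by rewrite -[x]add0r memv_add ?mem0v // memv_span.
      rewrite rpredZ // memv_add ?memv_line // rpredN //.
    rewrite in_cons span_cons => /orP[/eqP ->|Ux]; last first.
      by rewrite -[x]add0r memv_add ?mem0v // memv_span.
    rewrite -(subrK p b) memv_add //; apply/vlineP; exists s.
    by rewrite scalerA mulfV ?scale1r // gt_eqF.
Qed.

(** * Counting lattice points in boxes along the chain *)

(* Quantifying over the corner [w] is what lets the count pass to the cosets
   of a sublattice. *)
Definition box_count (L : set E) U (c : R) (K : nat) :=
  forall w, exists2 X : seq E, uniq X /\ size X = K &
    {in X, forall x, L x /\ {in U, forall u, 0 <= dot (x - w) u < c}}.

Lemma box_count_index s b U (c : R) K : ~ zspan s b ->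
  box_count (zspan s) U c K -> box_count (zspan (rcons s b)) U c (2 * K).
Proof.
move=> sNb H w; have [X [uX sX] XP] := H w; have [Y [uY sY] YP] := H (w - b).
exists (X ++ [seq y + b | y <- Y]).
  rewrite size_cat size_map sX sY mul2n addnn; split=> //.
  rewrite cat_uniq uX map_inj_uniq ?uY ?andbT /=; last exact: addIr.
  apply/hasPn => _ /mapP[y Yy ->]; apply/negP => Xyb; apply: sNb.
  rewrite -[b](addKr y) addrC; apply: zspanB; first by case: (XP _ Xyb).
  by case: (YP _ Yy).
move=> x; rewrite mem_cat => /orP[/XP|/mapP[y /YP [sy Uy] ->]].
  move=> [sx Ux]; split=> //; apply/zspan_rcons; exists x => //.
  by exists 0; rewrite addr0.
split; first by apply/zspan_rcons; exists y => //; exists 1.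
by move=> u /Uy; rewrite opprB addrA.
Qed.

(** Since [zspan s] is orthogonal to [u], its translate by [b *~ k] lies in the hyperplane where the
    component along [u] is [k] times [dot b u]. Distinct multiples thus give disjoint layers, each
    with [K] points. The direction [u] is not yet confined to the box. *)
Lemma box_count_slabs s b U u (c : R) K (k0 : int) (j : nat) w :
  {in << s >>%VS, forall x, dot x u = 0} -> 0 < dot b u ->
  box_count (zspan s) U c K ->
  exists2 X : seq E, uniq X /\ size X = (j * K)%N &
    {in X, forall x, [/\ zspan (rcons s b) x,
      {in U, forall u, 0 <= dot (x - w) u < c} &
      exists2 k : nat, (k < j)%N & dot x u = (k0 + k%:Z)%:~R * dot b u]}.
Proof.
move=> su b0 H; elim: j => [|j [X [uX sX] XP]]; first by exists [::].
(* Points counted in the box with corner [w - e] land, after translation by [e], in the box with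
   corner [w]. *)
pose e := b *~ (k0 + j%:Z); have [Y [uY sY] YP] := H (w - e).
have Yu y : y \in Y -> dot (y + e) u = (k0 + j%:Z)%:~R * dot b u.
  by case/YP => /zspan_span/su yu _; rewrite dotDl yu add0r dotMzl.
exists (X ++ [seq y + e | y <- Y]).
  rewrite size_cat size_map sX sY addnC -mulSn; split=> //.
  rewrite cat_uniq uX map_inj_uniq ?uY ?andbT /=; last exact: addIr.
  apply/hasPn => _ /mapP[y Yy ->]; apply/negP => /XP[_ _ [k kj]].
  rewrite Yu // => /(mulIf (lt0r_neq0 b0)) /eqP; rewrite eqr_int.
  by move/eqP/addrI => [jk]; rewrite jk ltnn in kj.
move=> x; rewrite mem_cat => /orP[/XP [sx Ux [k kj xu]]|/mapP[y Yy ->]].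
  by split=> //; exists k => //; exact: leqW.
have [sy Uy] := YP _ Yy; split.
- by apply/zspan_rcons; exists y => //; exists (k0 + j%:Z).
- by move=> v /Uy; rewrite opprB addrA.
- by exists j => //; exact: Yu.
Qed.

Lemma box_count_rank s b U u (c : R) K (n : nat) :
  {in << s >>%VS, forall x, dot x u = 0} -> 0 < dot b u ->
  n%:R * dot b u <= c ->
  box_count (zspan s) U c K ->
  box_count (zspan (rcons s b)) (u :: U) c (n * K).
Proof.
(* [k0] is the first layer at or above the corner along [u]. It exceeds the corner by less than
   [dot b u], so the last of [n] consecutive layers exceeds it by less than [n * dot b u <= c]. *)
move=> su b0 nc H w; set k0 := Num.ceil (dot w u / dot b u).
have [X XK XP] := box_count_slabs k0 n w su b0 H.
exists X => // x /XP [sx Ux [k kn xu]]; split=> // v.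
rewrite in_cons => /orP[/eqP ->|/Ux //]; rewrite dotBl xu intrD.
have := ceil_itv (dot w u / dot b u); rewrite -/k0 => /andP[k0l k0u].
have kn1 : k%:R + 1 <= n%:R :> R by rewrite -(natrD _ k 1) ler_nat addn1.
rewrite ltr_pdivlMr // ler_pdivrMr // intrB in k0l k0u.
rewrite -[k%:Z%:~R]/(k%:R : R).
have kb : 0 <= k%:R * dot b u by rewrite mulr_ge0 // ltW.
have := ler_wpM2r (ltW b0) kn1.
by lra.
Qed.

(** Here [size U] is the number of rank steps and [N] that of index steps. Neither depends on [n],
    which is what allows [n] to tend to infinity later. *)
Lemma chain_box_count (B : R) (s : seq E) :
  {in s, forall b, enorm dot b <= B} ->
  exists U N, [/\ is_orthonormal U, <<U>>%VS = << s >>%VS,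
    (\sum_(0 <= i < size s) `[< zspan (take i s) `<` zspan (take i.+1 s) >]
       <= size U + N)%N &
    forall n, box_count (zspan s) U (n%:R * B) (2 ^ N * n ^ size U)].
Proof.
elim/last_ind: s => [|s b IH] sB.
  (* Without axes the box condition is vacuous, so the point [0] alone gives the required count
     1. *)
  exists [::], 0%N; split; rewrite ?big_nil // => n w.
  exists [:: 0] => // x; rewrite inE => /eqP ->; split=> //; exact: zspan0.
have [|U [N [oU Us cU HU]]] := IH.
  by move=> x sx; apply: sB; rewrite mem_rcons in_cons sx orbT.
have bB : enorm dot b <= B by apply: sB; rewrite mem_rcons mem_head.
have -> : (\sum_(0 <= i < size (rcons s b))
    `[< zspan (take i (rcons s b)) `<` zspan (take i.+1 (rcons s b)) >] =
  \sum_(0 <= i < size s) `[< zspan (take i s) `<` zspan (take i.+1 s) >] +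
    `[< zspan s `<` zspan (rcons s b) >])%N.
  rewrite size_rcons big_nat_recr //=; congr (_ + _)%N; last first.
    by rewrite -{1}cats1 take_size_cat // take_oversize // size_rcons.
  apply: eq_big_nat => i /andP[_ lt_is].
  by rewrite -cats1 !takel_cat // ltnW.
have srE : <<rcons s b>>%VS = (<[b]> + << s >>)%VS.
  by rewrite -cats1 span_cat span_seq1 addvC.
(* If [b] lies in the real span, either it is already in the lattice and nothing changes, or this is
   an index step. *)
have [bU|bNU] := boolP (b \in <<U>>%VS).
  have srU : <<U>>%VS = <<rcons s b>>%VS.
    by rewrite srE -Us; apply/esym/addv_idPr; rewrite -memvE.
  have [sb|sNb] := pselect (zspan s b).
    exists U, N; split=> //.
      by rewrite (asboolF (zspan_rcons_mem sb)) addn0.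
    move=> n w; have [X XK XP] := HU n w; exists X => // x /XP[sx Ux].
    by split=> //; apply/zspan_rcons; exists x => //; exists 0; rewrite addr0.
  exists U, N.+1; split=> //; first by rewrite addnS -addn1 leq_add // leq_b1.
  by move=> n; rewrite expnS -mulnA; exact: box_count_index.
(* Rank step: the new axis [u] comes from Gram-Schmidt. *)
have [u ouU [/andP[bu0 buB] uUE]] := gram_schmidt_step oU bNU.
exists (u :: U), N; split=> //.
- by rewrite uUE srE span_cons Us.
- by rewrite /= addSn -addn1 leq_add // leq_b1.
move=> n; rewrite /= expnS mulnCA; apply: box_count_rank => //.
- move=> x; rewrite -Us => /span_orthogonal; apply => w Uw.
  case: ouU => uU ->; rewrite ?mem_head ?in_cons ?Uw ?orbT //.
  by case: eqP Uw uU => // -> /= ->.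
- by rewrite ler_wpM2l // (le_trans buB).
Qed.

End InnerProduct.


(** * Factorial estimate and passage to the limit *)

(** Multiply the factorial by itself in reverse order: each product [(i + 1) * (d - i)] with [i < d]
    is at least [d]. *)
Lemma expnn_le_sqr_fact d : (d ^ d <= d`! ^ 2)%N.
Proof.
rewrite expnS expn1 {2}fact_prod fact_prod big_add1 big_mkord.
rewrite {2}(reindex_inj rev_ord_inj) -big_split /=.
rewrite -{1 2}(card_ord d) -prod_nat_const; apply: leq_prod => i _ /=.
rewrite card_ord subnSK //; have := ltn_ord i; nia.
Qed.

Lemma sqrt_expn_le_fact (R : rcfType) d : Num.sqrt d%:R ^+ d <= d`!%:R :> R.
Proof.
rewrite -ler_sqr ?nnegrE ?exprn_ge0 ?sqrtr_ge0 ?ler0n // exprAC sqr_sqrtr //.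
by rewrite -!natrX ler_nat expnn_le_sqr_fact.
Qed.

Lemma expr_bound_limit (R : realType) (K A : R) d :
  (forall n : nat, K * n%:R ^+ d <= (n%:R * A + 1) ^+ d) -> K <= A ^+ d.
Proof.
move=> H; have cvA : A + harmonic n @[n --> \oo] --> A.
  rewrite -[X in _ --> X]addr0; apply: cvgD; first exact: cvg_cst.
  exact: cvg_harmonic.
have cv : (fun n => (A + harmonic n) ^+ d) @ \oo --> (A ^+ d : R).
  apply: (@continuous_cvg _ R _ _ _ _ (fun x : R => x ^+ d)) cvA.
  exact: exprn_continuous.
rewrite -(cvg_lim _ cv) //; apply: limr_ge.
  by apply/cvg_ex; exists (A ^+ d).
(* The hypothesis is used at [n.+1], as [harmonic n] is the inverse of [n.+1]. *)
near=> n; have n0 : 0 < n.+1%:R :> R by rewrite ltr0n.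
rewrite -(ler_pM2r (exprn_gt0 d n0)) -exprMn mulrDl mulVf ?gt_eqF //.
by rewrite (mulrC A); exact: H.
Unshelve. all: by end_near. Qed.

(** * Packing bound and first minimum *)

Section Packing.
Set Implicit Arguments.
Unset Strict Implicit.
Context (R : realType) (E : vectType R) (dot : {dot E for idfun}).
Implicit Types (x y u w b : E) (U : seq E).

(** Pigeonhole with half-open cubes of side [l / sqrt d]: by Parseval, two points in one cube are at
    distance less than [l]. The number [q] is the inverse side, and [f] sends a point to its cube,
    one of [T + 1] along each axis. *)
Lemma packing_bound U (X : seq E) w (c l : R) :
  is_orthonormal dot U -> <<U>>%VS = fullv -> 0 < l -> 0 <= c -> uniq X ->
  {in X &, forall x y, x != y -> l <= enorm dot (x - y)} ->
  {in X, forall x, {in U, forall u, 0 <= dot (x - w) u < c}} ->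
  (size X)%:R <= (c * Num.sqrt (size U)%:R / l + 1) ^+ size U.
Proof.
move=> oU Uf l0 c0 uX sepX XP; rewrite -mulrA.
set d := size U; set q := Num.sqrt _ / l.
have q0 : 0 <= q by rewrite divr_ge0 ?sqrtr_ge0 // ltW.
pose T := Num.truncn (c * q).
pose f x := [ffun j : 'I_d =>
  inord (Num.truncn (dot (x - w) U`_j * q)) : 'I_T.+1].
have fP x (j : 'I_d) : x \in X ->
    (f x j)%:R <= dot (x - w) U`_j * q < (f x j)%:R + 1.
  move=> Xx; have /andP[p0 pc] := XP x Xx U`_j (mem_nth 0 (ltn_ord j)).
  have pq0 : 0 <= dot (x - w) U`_j * q by exact: mulr_ge0.
  rewrite ffunE inordK; first by rewrite natr1 truncn_itv.
  by rewrite ltnS le_truncn // ler_wpM2r // ltW.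
have finj : {in X &, injective f}.
  move=> x y Xx Xy fxy; apply/eqP/negPn/negP => xy.
  (* The strict comparison of sums below needs at least one axis; without axes the space is zero and
     [x = y]. *)
  have d0 : (0 < d)%N.
    rewrite lt0n size_eq0; apply: contraNneq xy => U0.
    by rewrite -subr_eq0 -memv0 -span_nil -U0 Uf memvf.
  have := sepX x y Xx Xy xy; apply/negP; rewrite -ltNge.
  rewrite -ltr_sqr ?nnegrE ?enorm_ge0 ?(ltW l0) // sqr_enorm.
  rewrite (orthonormal_parseval oU) ?Uf ?memvf // (big_nth 0) big_mkord.
  have -> : l ^+ 2 = \sum_(i < size U) l ^+ 2 / d%:R.
    rewrite sumr_const card_ord -/d -[_ *+ d]mulr_natr divfK //.
    by rewrite pnatr_eq0 -lt0n.
  apply: ltr_sum.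
    by apply/hasP; exists (Ordinal d0); rewrite ?mem_index_enum.
  move=> i _; rewrite ltr_pdivlMr ?ltr0n //.
  have := fP x i Xx; have := fP y i Xy; rewrite fxy.
  have -> : x - y = (x - w) - (y - w) by rewrite opprB addrA subrK.
  rewrite (dotBl _ (x - w)); set a := dot (x - w) _; set a' := dot (y - w) _.
  set k := (_)%:R => ha ha'.
  have hq : `|(a - a') * q| < 1 by rewrite ltr_norml; lra.
  have : ((a - a') * q) ^+ 2 < 1.
    by rewrite -[_ ^+ 2]ger0_norm ?sqr_ge0 // normrX expr_lt1.
  rewrite /q exprMn exprMn sqr_sqrtr // exprVn mulrA.
  by rewrite ltr_pdivrMr ?exprn_gt0 // mul1r.
have -> : (size X = size [seq f x | x <- X])%N by rewrite size_map.
have /card_uniqP <- : uniq [seq f x | x <- X] by rewrite map_inj_in_uniq.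
apply: (@le_trans _ _ ((T.+1 ^ d)%N)%:R).
  by rewrite ler_nat (leq_trans (max_card _)) // card_ffun !card_ord.
rewrite natrX lerXn2r ?nnegrE // ?addr_ge0 ?(mulr_ge0 c0) //.
by rewrite -natr1 lerD2r truncn_le (mulr_ge0 c0).
Qed.

(** By Parseval each coordinate along [U] is at most the norm. Applied to the coordinates in a
    lattice basis, this yields discreteness. *)
Lemma scalar_bound U (f : {scalar E}) : is_orthonormal dot U ->
  <<U>>%VS = fullv -> exists2 C, 0 <= C & forall x, `|f x| <= C * enorm dot x.
Proof.
move=> oU Uf; exists (\sum_(u <- U) `|f u|); first exact: sumr_ge0.
move=> x; have xU : x \in <<U>>%VS by rewrite Uf memvf.
rewrite {1}(orthonormal_expand oU xU) linear_sum mulr_suml.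
rewrite (le_trans (ler_norm_sum _ _ _)) // big_seq [leRHS]big_seq.
apply: ler_sum => u Uu; rewrite linearZ /= normrM mulrC ler_wpM2l //.
rewrite -ler_sqr ?nnegrE ?enorm_ge0 // sqr_enorm real_normK ?num_real //.
rewrite (orthonormal_parseval oU xU) (bigD1_seq u) //=; last by case: oU.
by rewrite lerDl sumr_ge0 // => v _; exact: sqr_ge0.
Qed.

(** Lattice vectors no longer than [x0] have integer coordinates bounded by some [K] in a basis of
    [L], so the minimum is over a finite set. *)
Lemma lattice_shortest_vector U (L : set E) x0 : is_orthonormal dot U ->
  <<U>>%VS = fullv -> is_lattice L -> L x0 -> x0 != 0 ->
  exists2 x1, L x1 /\ x1 != 0 &
    forall x, L x -> x != 0 -> enorm dot x1 <= enorm dot x.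
Proof.
move=> oU Uf [b [fb ->]] Lx0 x00; pose r := size b.
have [C C0 Cb] : exists2 C, 0 <= C &
    forall (j : 'I_r) x, `|coord (in_tuple b) j x| <= C * enorm dot x.
  have H (j : 'I_r) := scalar_bound (coord (in_tuple b) j) oU Uf.
  pose C j := s2val (cid2 (H j)).
  have C0 j : 0 <= C j by exact: (s2valP (cid2 (H j))).
  have CP j x : `|coord (in_tuple b) j x| <= C j * enorm dot x.
    exact: (s2valP' (cid2 (H j))).
  exists (\sum_j C j) => [|j x]; first exact: sumr_ge0.
  rewrite (le_trans (CP j x)) // ler_wpM2r ?enorm_ge0 // (bigD1 j) //= lerDl.
  exact: sumr_ge0.
pose K := Num.truncn (C * enorm dot x0).
(* Coordinates from [-K] to [K] are stored shifted by [K], which makes the index type finite. *)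
pose pt (g : {ffun 'I_r -> 'I_(K + K).+1}) : E :=
  \sum_(j < r) b`_j *~ ((g j)%:Z - K%:Z).
have ptL g : zspan b (pt g).
  by exists [ffun j => (g j)%:Z - K%:Z]; apply: eq_bigr => j _; rewrite ffunE.
have ptP x : zspan b x -> enorm dot x <= enorm dot x0 -> exists g, x = pt g.
  move=> [a xE] xx0; have aK (j : 'I_r) : (`|a j| <= K)%N.
    have := Cb j x; rewrite {1}xE.
    under eq_bigr do rewrite -scaler_int.
    rewrite coord_sum_free // => aC.
    rewrite /K truncn_ge_nat ?mulr_ge0 ?enorm_ge0 //.
    rewrite natr_absz intr_norm (le_trans aC) //.
    by rewrite ler_wpM2l.
  exists [ffun j : 'I_r => inord (absz (a j + K%:Z))]; rewrite xE.
  apply: eq_bigr => j _; congr (_ *~ _).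
  rewrite ffunE inordK; have := aK j; lia.
have [g0 g0E] := ptP x0 Lx0 (lexx _).
have g0P : pt g0 != 0 by rewrite -g0E.
case: (arg_minP (P := fun g => pt g != 0) (fun g => enorm dot (pt g)) g0P).
move=> g1 g1P g1min.
exists (pt g1) => // x Lx x0'.
have [xx0|/ltW xx0] := leP (enorm dot x) (enorm dot x0).
  by have [g gE] := ptP x Lx xx0; rewrite gE g1min // -gE.
by rewrite (le_trans _ xx0) // g0E g1min.
Qed.

Lemma successive_minimum1P U (L : set E) x0 (l := successive_minimum dot L 1) :
  is_orthonormal dot U -> <<U>>%VS = fullv -> is_lattice L -> L x0 -> x0 != 0 ->
  0 < l /\ forall x, L x -> x != 0 -> l <= enorm dot x.
Proof.
move=> oU Uf Ll Lx0 x00.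
have [x1 [Lx1 x10] x1min] := lattice_shortest_vector oU Uf Ll Lx0 x00.
rewrite /l /successive_minimum; set S := [set r | _].
have Sx x : L x -> x != 0 -> S (enorm dot x).
  move=> Lx xn0; exists [tuple x]; first by rewrite seq1_free.
  by move=> y; rewrite inE => /eqP ->.
have Slb r : S r -> exists x, [/\ L x, x != 0 & enorm dot x <= r].
  case=> X fX XP; exists (thead X).
  have hX : thead X \in tval X by rewrite mem_tnth.
  have [LX rX] := XP _ hX; split=> //; exact: (free_not0 fX hX).
(* The norm of a shortest vector is a least admissible radius, so [xget] does not fall back on its
   default 0. *)
have [|Sl lbl] := @xgetPex _ 0 (S `&` lbound S).
  exists (enorm dot x1); split; first exact: Sx.
  by move=> r /Slb[x [Lx xn0]]; apply: le_trans; exact: x1min.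
split; last by move=> x Lx xn0; apply: lbl; exact: Sx.
by have [x [_ xn0]] := Slb _ Sl; apply: lt_le_trans; exact: enorm_gt0.
Qed.

Lemma enorm_le_max_norm (s : seq E) :
  {in s, forall x, enorm dot x <= max_norm dot s}.
Proof. by move=> x sx; rewrite /max_norm le_bigmax_seq. Qed.

Lemma max_norm_ge0 (s : seq E) : 0 <= max_norm dot s.
Proof.
by rewrite /max_norm; elim/big_rec: _ => // x y _ y0; rewrite le_max y0 orbT.
Qed.

End Packing.

(** * Conclusion *)

(** Only an inequality: the sum also counts the inclusion of the lattice 0 in the first lattice of
    the chain. *)
Lemma strict_inclusions_le_sum (V : zmodType) (m : nat) (v : m.-tuple V) :
  (strict_inclusions v <=
   \sum_(0 <= i < size v) `[< zspan (take i v) `<` zspan (take i.+1 v) >])%N.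
Proof.
rewrite /strict_inclusions -sum1_card big_mkcond size_tuple big_mkord.
by apply: leq_sum => i _; rewrite inE; case: (0 < i)%N => //=; case: asbool.
Qed.

Lemma le_log2 (R : realType) (N : nat) (Q : R) :
  (2 ^ N)%N%:R <= Q -> N%:R <= log2 Q.
Proof.
move=> NQ; have ln2 : 0 < ln 2 :> R by rewrite ln_gt0 // ltr1n.
rewrite /log2 ler_pdivlMr // mulr_natl -lnXn // -natrX ler_ln // posrE.
  by rewrite ltr0n expn_gt0.
by apply: lt_le_trans NQ; rewrite ltr0n expn_gt0.
Qed.

Theorem theorem3p1 (R : realType) (E : vectType R) (dot : {dot E for idfun})
    (d m : nat) (v : m.-tuple E) (L : set E) :
  \dim (fullv : {vspace E}) = d ->
  <<v>>%VS = fullv ->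
  is_lattice L ->
  L = zspan v ->
  (strict_inclusions v)%:R <=
    d%:R + log2 ((d`!)%:R *
                 (max_norm dot v / successive_minimum dot L 1) ^+ d).
Proof.
move=> dimE spanv latL LE; set B := max_norm dot v.
set l := successive_minimum _ _ _.
have [U [N [oU Uv countU boxU]]] :=
  chain_box_count (@enorm_le_max_norm _ _ dot v).
rewrite -/B in boxU; have Uf : <<U>>%VS = fullv by rewrite Uv.
have dU : size U = d by rewrite -(eqP (is_orthonormal_free oU)) Uf.
(* For [d = 0] the minimum [l] is the junk value [0]; use [1] instead. *)
have [l' l'0 [sep l'E]] : exists2 l', 0 < l' &
    (forall x, L x -> x != 0 -> l' <= enorm dot x) /\
    (B / l') ^+ d = (B / l) ^+ d.
  have [d0|d0] := posnP d.
    exists 1 => //; split=> [x _|]; last by rewrite d0 !expr0.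
    have /eqP U0 : U == [::] by rewrite -size_eq0 dU d0.
    by rewrite -memv0 -span_nil -U0 Uf memvf.
  (* In positive dimension the generators cannot all vanish. *)
  have [x0 vx0 x00] : exists2 x0, x0 \in tval v & x0 != 0.
    apply/hasP; apply: contraTT d0 => /hasPn v0; rewrite -eqn0Ngt -dimE -spanv.
    rewrite dimv_eq0 -subv0; apply/span_subvP => x /v0 /negPn/eqP ->.
    exact: mem0v.
  have Lx0 : L x0 by rewrite LE; exact: mem_zspan.
  by have [? ?] := successive_minimum1P oU Uf latL Lx0 x00; exists l.
have key : (2 ^ N)%N%:R <= d`!%:R * (B / l) ^+ d :> R.
  (* The factorial absorbs the [d]-th power of [sqrt d]; what remains follows by comparing the box
     count and the packing bound for every [n]. *)
  rewrite -l'E (@le_trans _ _ ((Num.sqrt d%:R * (B / l')) ^+ d)) //; last first.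
    rewrite exprMn ler_wpM2r ?sqrt_expn_le_fact // exprn_ge0 //.
    by rewrite divr_ge0 ?max_norm_ge0 // ltW.
  apply: expr_bound_limit => n; have [X [uX sX] XP] := boxU n 0.
  rewrite -natrX -natrM -{1}dU -sX.
  have := @packing_bound _ _ dot U X 0 (n%:R * B) l' oU Uf l'0.
  rewrite dU.
  have -> : n%:R * B * Num.sqrt d%:R / l' = n%:R * (Num.sqrt d%:R * (B / l')).
    by ring.
  apply=> //.
  - by rewrite mulr_ge0 ?max_norm_ge0.
  - move=> x y /XP[Lx _] /XP[Ly _] xy; apply: sep; rewrite ?subr_eq0 // LE.
    exact: zspanB.
  - by move=> x /XP[].
rewrite (le_trans _ (lerD (lexx _) (le_log2 key))) // -natrD ler_nat -dU.
exact: leq_trans (strict_inclusions_le_sum v) countU.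
Qed.
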